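(* Suppose that $\lambda_0,\lambda_1,\lambda_2,\lambda_3$ are real numbers. Then for all $n\ge3$ and all $t_1<\dots<t_n$ the entries $R_{j,j}$, as well as $R_{j,j-1}$ and $R_{j,j+1}$ ($j=2,\dots,n-1$), are positive numbers.
   Context: For $(\mu_0,\dots,\mu_N)\in\mathbb{C}^{N+1}$ let $\Phi_{(\mu_0,\dots,\mu_N)}$ (the fundamental function) be the unique solution of $\prod_{j=0}^N(\frac{d}{dx}-\mu_j)\Phi=0$ on $\mathbb{R}$ with $\Phi^{(k)}(0)=0$ for $k=0,\dots,N-1$ and $\Phi^{(N)}(0)=1$. Define for $x\ne0$ (for real exponents the denominators vanish only at $0$) $$\rho(x)=\frac{\Phi'_{(\lambda_0,\dots,\lambda_3)}(x)\Phi_{(\lambda_0,\lambda_1)}(x)-\Phi_{(\lambda_0,\dots,\lambda_3)}(x)\Phi'_{(\lambda_0,\lambda_1)}(x)}{\Phi_{(\lambda_0,\lambda_1)}(x)\Phi_{(\lambda_2,\lambda_3)}(x)},\qquad \sigma(x)=\frac{\Phi_{(\lambda_0,\dots,\lambda_3)}(x)}{\Phi_{(\lambda_0,\lambda_1)}(x)\Phi_{(\lambda_2,\lambda_3)}(x)}.$$ For $t_1<\dots<t_n$ and $j=2,\dots,n-1$ the entries of the tridiagonal matrix $R$ are $$R_{j,j}=\rho(t_j-t_{j-1})-\rho(-(t_{j+1}-t_j)),\quad R_{j,j+1}=\sigma(t_{j+1}-t_j),\quad R_{j,j-1}=-\sigma(-(t_j-t_{j-1})).$$ (The $(n-2)\times(n-2)$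 matrix is $R=(R_{i,j})_{2\le i,j\le n-1}$; the numbers $R_{2,1}$ and $R_{n-1,n}$ are also defined by these formulas.) *)

(* Defs.v *)
From Stdlib Require Import Reals List Arith ClassicalEpsilon.
From Coquelicot Require Import Coquelicot.
Import ListNotations.

Open Scope R_scope.

(* Coquelicot's [Derive] is limited to real-valued functions, and its
   [C_derive] is the derivative with respect to a complex variable. *)
Definition DeriveC (f : R -> C) : R -> C :=
  fun x => (Derive (fun y => Re (f y)) x, Derive (fun y => Im (f y)) x).

Definition DeriveC_n (k : nat) (f : R -> C) : R -> C := Nat.iter k DeriveC f.

Definition diff_op (mu : list C) (f : R -> C) : R -> C :=
  fold_right (fun (m : C) (g : R -> C) (x : R) =>
                Cminus (DeriveC g x) (Cmult m (g x))) f mu.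

(* [mu] lists mu_0, ..., mu_N, so [length mu] is N + 1.  [DeriveC] is total,
   hence the explicit requirement that f be N + 1 times differentiable. *)
Definition is_fundamental (mu : list C) (f : R -> C) : Prop :=
  (forall k x, (k < length mu)%nat ->
     @ex_derive R_AbsRing C_R_NormedModule (DeriveC_n k f) x) /\
  (forall x, diff_op mu f x = RtoC 0) /\
  (forall k, (k < pred (length mu))%nat -> DeriveC_n k f 0 = RtoC 0) /\
  DeriveC_n (pred (length mu)) f 0 = RtoC 1.

Definition Phi (mu : list C) : R -> C :=
  epsilon (inhabits (fun _ : R => RtoC 0)) (is_fundamental mu).

Definition rho (l0 l1 l2 l3 : C) (x : R) : C :=
  let F := Phi [l0; l1; l2; l3] in
  let P := Phi [l0; l1] in
  let Q := Phi [l2; l3] in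
  Cdiv (Cminus (Cmult (DeriveC F x) (P x)) (Cmult (F x) (DeriveC P x)))
       (Cmult (P x) (Q x)).

Definition sigma (l0 l1 l2 l3 : C) (x : R) : C :=
  let F := Phi [l0; l1; l2; l3] in
  let P := Phi [l0; l1] in
  let Q := Phi [l2; l3] in
  Cdiv (F x) (Cmult (P x) (Q x)).

(* The points t_1, ..., t_n are the values of t at 1, ..., n.  The entries
   that are used have 2 <= i <= n - 1 and 1 <= j <= n. *)
Definition Rmat (l0 l1 l2 l3 : C) (t : nat -> R) (i j : nat) : C :=
  if Nat.eq_dec j i then
    Cminus (rho l0 l1 l2 l3 (t j - t (j - 1)%nat))
           (rho l0 l1 l2 l3 (- (t (j + 1)%nat - t j)))
  else if Nat.eq_dec j (i + 1) then
    sigma l0 l1 l2 l3 (t (i + 1)%nat - t i)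
  else if Nat.eq_dec (j + 1) i then
    Copp (sigma l0 l1 l2 l3 (- (t i - t (i - 1)%nat)))
  else RtoC 0.

Definition Cpositive (z : C) : Prop := Im z = 0 /\ 0 < Re z.

(* Main.v *)
Require Import Defs.
From Stdlib Require Import Reals List Arith.
From Coquelicot Require Import Coquelicot.
From Stdlib Require Import Lra Lia FunctionalExtensionality ClassicalEpsilon.
Import ListNotations.

Open Scope R_scope.

(** For real exponents the fundamental function can be built one exponent at
    a time: if [g] is fundamental for [mu], then the solution [h] of
    h' = m h + g, h(0) = 0, namely [volterra m g], is fundamental for
    [m :: mu] ([real_fundamental_volterra]).  A linear initial value problem
    has one solution ([diff_op_unique]), so this [h] is the function chosen
    by [Phi] ([Phi_real]).

    Write P, Q, F for the fundamental functions of (a, b), (c, d) and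
    (a, b, c, d).  All signs come from one remark on h' = m h + g, h(0) = 0:
    the mean value theorem for exp(- m x) h(x) gives
    h(x) = exp(m (x - c)) g(c) x for some c strictly between 0 and x.  So a
    forcing term that is positive off 0 gives h the sign of x, and a forcing
    term with the sign of x makes h positive off 0.  Starting from an
    exponential, the successive integrations show that P, Q and F have the
    sign of x; hence PQ is positive off 0, and sigma = F / (PQ) has the
    sign of x.

    The numerator W = F' P - F P' of rho obeys an equation of the same kind.
    Indeed (d/dx - a)(d/dx - b) kills P and maps F to Q, that is
    P'' = (a + b) P' - a b P and F'' = (a + b) F' - a b F + Q.  Therefore
    W' = F'' P - F P'' = (a + b) W + P Q, with W(0) = 0 and PQ positive off
    0, and W has the sign of x, as has rho = W / (PQ).  The three positivity
    claims are these two sign rules, read at a gap between neighbouring points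
    or at the negative of a gap. *)

(** * Signs of solutions of first order equations *)

(** The integrating factor exp(- m x) turns the equation into
    (exp(- m x) h)' = exp(- m x) g, to which the mean value theorem applies.
    The factor [x] keeps the orientation of the interval, so that both signs
    of [x] are covered at once. *)
Lemma first_order_mean_value (m : R) (h g : R -> R) :
  (forall x, is_derive h x (m * h x + g x)) -> h 0 = 0 ->
  forall x, x <> 0 ->
  exists c, 0 < x * c /\ h x = exp (m * (x - c)) * g c * x.
Proof.
  intros Dh h0 x Hx.
  set (k := fun y => exp (- m * y) * h y).
  assert (Dk : forall y, derivable_pt_lim k y (exp (- m * y) * g y)).
  { intros y. apply is_derive_Reals. unfold k.
    evar_last.
    - apply (is_derive_mult (fun y => exp (- m * y)) h y (- m * exp (- m * y))
        (m * h y + g y)).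
      + auto_derive; [trivial | ring].
      + apply Dh.
      + exact Rmult_comm.
    - unfold plus, mult; simpl. ring. }
  assert (k0 : k 0 = 0) by (unfold k; rewrite h0; ring).
  assert (Hc : exists c, 0 < x * c /\ k x = exp (- m * c) * g c * x).
  { destruct (Rtotal_order x 0) as [Hneg | [-> | Hpos]].
    - destruct (MVT_cor2 k _ x 0 Hneg (fun y _ => Dk y)) as [c [E [H1 H2]]].
      exists c. split; [nra | rewrite k0 in E; lra].
    - now destruct Hx.
    - destruct (MVT_cor2 k _ 0 x Hpos (fun y _ => Dk y)) as [c [E [H1 H2]]].
      exists c. split; [nra | rewrite k0 in E; lra]. }
  destruct Hc as [c [Hs Hk]]. exists c. split; [exact Hs |].
  replace (h x) with (exp (m * x) * k x).
  - rewrite Hk. replace (m * (x - c)) with (m * x + - m * c) by ring.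
    rewrite exp_plus. ring.
  - unfold k. rewrite <- Rmult_assoc, <- exp_plus.
    replace (m * x + - m * x) with 0 by ring. rewrite exp_0. ring.
Qed.

Lemma first_order_sign_even (m : R) (h g : R -> R) :
  (forall x, is_derive h x (m * h x + g x)) -> h 0 = 0 ->
  (forall x, x <> 0 -> 0 < g x) -> forall x, x <> 0 -> 0 < x * h x.
Proof.
  intros Dh h0 Hg x Hx.
  destruct (first_order_mean_value m h g Dh h0 x Hx) as [c [Hc ->]].
  assert (c <> 0) by (intros ->; lra).
  replace (x * _) with (exp (m * (x - c)) * g c * (x * x)) by ring.
  apply Rmult_lt_0_compat; [| now apply Rsqr_pos_lt].
  apply Rmult_lt_0_compat; [apply exp_pos | auto].
Qed.

Lemma first_order_sign_odd (m : R) (h g : R -> R) :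
  (forall x, is_derive h x (m * h x + g x)) -> h 0 = 0 ->
  (forall x, x <> 0 -> 0 < x * g x) -> forall x, x <> 0 -> 0 < h x.
Proof.
  intros Dh h0 Hg x Hx.
  destruct (first_order_mean_value m h g Dh h0 x Hx) as [c [Hc ->]].
  assert (c0 : c <> 0) by (intros ->; lra).
  rewrite Rmult_assoc. apply Rmult_lt_0_compat; [apply exp_pos |].
  specialize (Hg c c0).
  apply (Rmult_lt_reg_r (c * c)); [now apply Rsqr_pos_lt |].
  replace (g c * x * (c * c)) with ((c * g c) * (x * c)) by ring.
  rewrite Rmult_0_l. now apply Rmult_lt_0_compat.
Qed.

(** * Real fundamental functions *)

Definition smooth (f : R -> R) : Prop := forall n x, ex_derive (Derive_n f n) x.

Definition first_order_op (m : R) (f : R -> R) : R -> R :=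
  fun x => Derive f x - m * f x.

Lemma Derive_n_first_order_op (m : R) (f : R -> R) : smooth f ->
  forall n, Derive_n (first_order_op m f) n =
    (fun x => Derive_n f (S n) x - m * Derive_n f n x).
Proof.
  intros Hf n. induction n as [|n IH]; [reflexivity |].
  change (Derive_n (first_order_op m f) (S n))
    with (Derive (Derive_n (first_order_op m f) n)).
  rewrite IH. extensionality x.
  rewrite Derive_minus, Derive_scal; [reflexivity | apply (Hf (S n)) |].
  apply ex_derive_scal. apply Hf.
Qed.

Lemma smooth_first_order_op (m : R) (f : R -> R) :
  smooth f -> smooth (first_order_op m f).
Proof.
  intros Hf n x. rewrite Derive_n_first_order_op by exact Hf.
  apply (ex_derive_minus (Derive_n f (S n))); [apply Hf |].
  apply (ex_derive_scal (Derive_n f n)), Hf.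
Qed.

Lemma first_order_op_comm (a b : R) (f : R -> R) : smooth f ->
  first_order_op a (first_order_op b f) = first_order_op b (first_order_op a f).
Proof.
  intros Hf. extensionality x.
  pose proof (equal_f (Derive_n_first_order_op a f Hf 1) x) as Ha.
  pose proof (equal_f (Derive_n_first_order_op b f Hf 1) x) as Hb.
  change (Derive (first_order_op a f) x = Derive_n f 2 x - a * Derive f x) in Ha.
  change (Derive (first_order_op b f) x = Derive_n f 2 x - b * Derive f x) in Hb.
  change (Derive (first_order_op b f) x - a * (Derive f x - b * f x) =
          Derive (first_order_op a f) x - b * (Derive f x - a * f x)).
  rewrite Ha, Hb. ring.
Qed.

Definition real_diff_op (mu : list R) (f : R -> R) : R -> R :=
  fold_right first_order_op f mu.

Lemma smooth_real_diff_op (mu : list R) (f : R -> R) :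
  smooth f -> smooth (real_diff_op mu f).
Proof.
  intros Hf. induction mu as [|m mu IH]; [exact Hf |].
  apply smooth_first_order_op, IH.
Qed.

(** The first exponent of the list is the outermost factor of the operator.
    It has to become the innermost one for the equation of [volterra m g] to
    be used; this is where the factors must commute. *)
Lemma real_diff_op_cons (m : R) (mu : list R) (f : R -> R) : smooth f ->
  real_diff_op (m :: mu) f = real_diff_op mu (first_order_op m f).
Proof.
  intros Hf. induction mu as [|m' mu IH]; [reflexivity |]. simpl in *.
  rewrite first_order_op_comm by (apply (smooth_real_diff_op mu f Hf)).
  now rewrite IH.
Qed.

(** The equation can be differentiated any number of times: this gives at once
    the smoothness of [h] and the recursion for its derivatives at 0. *)
Lemma Derive_n_first_order_ode (m : R) (h g : R -> R) :
  smooth g -> (forall x, is_derive h x (m * h x + g x)) ->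
  forall n x, is_derive (Derive_n h n) x (m * Derive_n h n x + Derive_n g n x).
Proof.
  intros Hg Dh n. induction n as [|n IH]; [exact Dh |]. intros x.
  change (Derive_n h (S n)) with (fun y => Derive (Derive_n h n) y).
  apply is_derive_ext with (fun y => m * Derive_n h n y + Derive_n g n y).
  { intros y. symmetry. apply is_derive_unique, IH. }
  apply (is_derive_plus (fun y => m * Derive_n h n y) (Derive_n g n)).
  - apply is_derive_scal, Derive_correct. eexists; apply IH.
  - apply Derive_correct, Hg.
Qed.

Lemma smooth_first_order_ode (m : R) (h g : R -> R) :
  smooth g -> (forall x, is_derive h x (m * h x + g x)) -> smooth h.
Proof.
  intros Hg Dh n x. eexists. now apply (Derive_n_first_order_ode m h g).
Qed.

(** Duhamel's formula for the solution of h' = m h + g, h(0) = 0. *)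
Definition volterra (m : R) (g : R -> R) : R -> R :=
  fun x => exp (m * x) * RInt (fun s => exp (- m * s) * g s) 0 x.

Lemma volterra_0 (m : R) (g : R -> R) : volterra m g 0 = 0.
Proof.
  unfold volterra. rewrite RInt_point. unfold zero; simpl. ring.
Qed.

Lemma is_derive_volterra (m : R) (g : R -> R) :
  (forall x, continuous g x) ->
  forall x, is_derive (volterra m g) x (m * volterra m g x + g x).
Proof.
  intros Cg x. unfold volterra.
  assert (Ck : forall y, continuous (fun s => exp (- m * s) * g s) y).
  { intros y. apply (continuous_mult (fun s => exp (- m * s)) g); [| apply Cg].
    apply (ex_derive_continuous (fun s => exp (- m * s))). auto_derive. trivial. }
  assert (E : exp (m * x) * exp (- m * x) = 1).
  { rewrite <- exp_plus. replace (m * x + - m * x) with 0 by ring. apply exp_0. }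
  evar_last.
  - apply (is_derive_mult (fun x => exp (m * x))
      (fun x => RInt (fun s => exp (- m * s) * g s) 0 x) x (m * exp (m * x))
      (exp (- m * x) * g x)).
    + auto_derive; [trivial | ring].
    + apply (is_derive_RInt (fun s => exp (- m * s) * g s) _ 0); [| apply Ck].
      apply filter_forall. intros y. apply (RInt_correct (V := R_CompleteNormedModule)).
      apply (ex_RInt_continuous (V := R_CompleteNormedModule)). intros; apply Ck.
    + exact Rmult_comm.
  - unfold plus, mult; simpl.
    replace (g x) with (exp (m * x) * exp (- m * x) * g x) at 2 by (rewrite E; ring).
    ring.
Qed.

Lemma smooth_continuous (f : R -> R) : smooth f -> forall x, continuous f x.
Proof.
  intros Hf x. apply (ex_derive_continuous f). apply (Hf 0%nat).
Qed.

(** Full smoothness is required here, rather than the least order for which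
    the operator makes sense, so that the factors of the operator commute. *)
Definition real_fundamental (mu : list R) (f : R -> R) : Prop :=
  smooth f /\ (forall x, real_diff_op mu f x = 0) /\
  (forall k, (k < pred (length mu))%nat -> Derive_n f k 0 = 0) /\
  Derive_n f (pred (length mu)) 0 = 1.

Lemma smooth_zero : smooth (fun _ => 0).
Proof.
  intros n x.
  apply ex_derive_ext with (fun _ => 0); [| apply ex_derive_const].
  intros y. destruct n; [reflexivity |]. now rewrite Derive_n_const.
Qed.

Lemma real_fundamental_exp (m : R) :
  real_fundamental [m] (fun x => exp (m * x)).
Proof.
  assert (D : forall x : R, is_derive (fun x : R => exp (m * x)) x (m * exp (m * x) + 0)).
  { intros x. auto_derive; [trivial | ring]. }
  split; [| split; [| split]].
  - now apply (smooth_first_order_ode m _ (fun _ => 0) smooth_zero).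
  - intros x. change (Derive (fun x => exp (m * x)) x - m * exp (m * x) = 0).
    rewrite (is_derive_unique _ _ _ (D x)). ring.
  - simpl. lia.
  - simpl. now rewrite Rmult_0_r, exp_0.
Qed.

(** In h^(k+1)(0) = m h^(k)(0) + g^(k)(0), the vanishing derivatives of [g]
    give one more vanishing derivative to [h], and the first one that equals 1
    is passed on. *)
Lemma real_fundamental_volterra (m : R) (mu : list R) (g : R -> R) :
  real_fundamental mu g -> real_fundamental (m :: mu) (volterra m g).
Proof.
  intros (Sg & Og & Zg & Ig).
  pose proof (is_derive_volterra m g (smooth_continuous g Sg)) as D.
  pose proof (smooth_first_order_ode m _ g Sg D) as S.
  assert (Z : forall k, (k <= pred (length mu))%nat -> Derive_n (volterra m g) k 0 = 0).
  { induction k as [|k IH]; intros Hk; [apply volterra_0 |].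
    simpl. rewrite (is_derive_unique _ _ _ (Derive_n_first_order_ode m _ g Sg D k 0)).
    rewrite IH, Zg by lia. ring. }
  destruct mu as [|m' mu].
  (* For the empty list the operator is the identity, so g = 0, against
     g(0) = 1. *)
  { exfalso. specialize (Og 0). simpl in Og, Ig. lra. }
  split; [exact S | split; [| split]].
  - intros x. rewrite real_diff_op_cons by exact S.
    replace (first_order_op m (volterra m g)) with g; [apply Og |].
    extensionality y. unfold first_order_op.
    rewrite (is_derive_unique _ _ _ (D y)). ring.
  - simpl length in *. intros k Hk. apply Z. simpl in *. lia.
  - simpl length in *. simpl pred in *.
    change (Derive (Derive_n (volterra m g) (length mu)) 0 = 1).
    rewrite (is_derive_unique _ _ _ (Derive_n_first_order_ode m _ g Sg D (length mu) 0)).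
    rewrite Z by lia. rewrite Ig. ring.
Qed.

(** * Identification with the complex fundamental function *)

Lemma DeriveC_RtoC (f : R -> R) :
  DeriveC (fun x => RtoC (f x)) = (fun x => RtoC (Derive f x)).
Proof.
  extensionality x. unfold DeriveC. simpl.
  rewrite Derive_const. reflexivity.
Qed.

Lemma DeriveC_n_RtoC (f : R -> R) (k : nat) :
  DeriveC_n k (fun x => RtoC (f x)) = (fun x => RtoC (Derive_n f k x)).
Proof.
  induction k as [|k IH]; [reflexivity |].
  change (DeriveC (DeriveC_n k (fun x => RtoC (f x))) =
          (fun x => RtoC (Derive (Derive_n f k) x))).
  rewrite IH. apply DeriveC_RtoC.
Qed.

Lemma diff_op_RtoC (mu : list R) (f : R -> R) :
  diff_op (map RtoC mu) (fun x => RtoC (f x)) =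
  (fun x => RtoC (real_diff_op mu f x)).
Proof.
  induction mu as [|m mu IH]; [reflexivity |].
  change (diff_op (map RtoC (m :: mu)) (fun x => RtoC (f x))) with
    (fun x => Cminus (DeriveC (diff_op (map RtoC mu) (fun x => RtoC (f x))) x)
                (Cmult (RtoC m) (diff_op (map RtoC mu) (fun x => RtoC (f x)) x))).
  rewrite IH, DeriveC_RtoC. extensionality x.
  now rewrite <- RtoC_mult, <- RtoC_minus.
Qed.

(** Differentiability with values in the real normed space C, read on
    components: this is the form that matches [DeriveC]. *)
Definition is_derive_C (f : R -> C) (x : R) (l : C) : Prop :=
  is_derive (fun y : R => Re (f y)) x (Re l) /\
  is_derive (fun y : R => Im (f y)) x (Im l).

Lemma ex_derive_is_derive_C (f : R -> C) (x : R) (l : C) :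
  is_derive_C f x l -> @ex_derive R_AbsRing C_R_NormedModule f x.
Proof.
  intros [Hu Hv]. eexists.
  apply (is_derive_ext (fun y =>
    plus (scal (Re (f y)) (RtoC 1) : C_R_NormedModule)
         (scal (Im (f y)) Ci : C_R_NormedModule))).
  - intros y. apply injective_projections; simpl;
    unfold scal, plus; simpl; unfold mult; simpl; unfold Re, Im; ring.
  - apply (@is_derive_plus R_AbsRing C_R_NormedModule);
    apply (@is_derive_scal_l R_AbsRing C_R_NormedModule); eassumption.
Qed.

Lemma is_fundamental_RtoC (mu : list R) (f : R -> R) :
  real_fundamental mu f -> is_fundamental (map RtoC mu) (fun x => RtoC (f x)).
Proof.
  intros (S & O & Z & I). split; [| split; [| split]].
  - intros k x _. rewrite DeriveC_n_RtoC.
    apply (ex_derive_is_derive_C _ x (RtoC (Derive (Derive_n f k) x))).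
    split; [apply Derive_correct, S |].
    apply (is_derive_const (K := R_AbsRing) (V := R_NormedModule) 0).
  - intros x. now rewrite diff_op_RtoC, O.
  - intros k Hk. rewrite length_map in Hk. now rewrite DeriveC_n_RtoC, Z.
  - now rewrite length_map, DeriveC_n_RtoC, I.
Qed.

Lemma is_derive_C_DeriveC (f : R -> C) (x : R) :
  @ex_derive R_AbsRing C_R_NormedModule f x -> is_derive_C f x (DeriveC f x).
Proof.
  intros Hf. apply ex_derive_filterdiff in Hf. destruct Hf as [l Hl].
  split; apply Derive_correct, ex_derive_filterdiff; eexists.
  - apply (filterdiff_comp' (V := C_R_NormedModule) f Re x l Re Hl).
    apply filterdiff_linear, is_linear_fst.
  - apply (filterdiff_comp' (V := C_R_NormedModule) f Im x l Im Hl).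
    apply filterdiff_linear, is_linear_snd.
Qed.

Lemma is_derive_C_unique (f : R -> C) (x : R) (l : C) :
  is_derive_C f x l -> DeriveC f x = l.
Proof.
  intros [Hr Hi]. apply injective_projections; simpl;
    apply is_derive_unique; assumption.
Qed.

Lemma is_derive_C_minus (f g : R -> C) (x : R) (lf lg : C) :
  is_derive_C f x lf -> is_derive_C g x lg ->
  is_derive_C (fun y => Cminus (f y) (g y)) x (Cminus lf lg).
Proof.
  intros [Fr Fi] [Gr Gi]. split.
  - exact (is_derive_minus (fun y : R => Re (f y)) (fun y : R => Re (g y)) x _ _ Fr Gr).
  - exact (is_derive_minus (fun y : R => Im (f y)) (fun y : R => Im (g y)) x _ _ Fi Gi).
Qed.

Lemma is_derive_C_scal (m : C) (f : R -> C) (x : R) (l : C) :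
  is_derive_C f x l -> is_derive_C (fun y => Cmult m (f y)) x (Cmult m l).
Proof.
  intros [Fr Fi]. split.
  - exact (is_derive_minus (fun y : R => Re m * Re (f y)) (fun y : R => Im m * Im (f y))
      x _ _ (is_derive_scal _ x (Re m) _ Fr) (is_derive_scal _ x (Im m) _ Fi)).
  - exact (is_derive_plus (fun y : R => Re m * Im (f y)) (fun y : R => Im m * Re (f y))
      x _ _ (is_derive_scal _ x (Re m) _ Fi) (is_derive_scal _ x (Im m) _ Fr)).
Qed.

(** The difference h of two solutions satisfies h' = m h, h(0) = 0.  Then
    |h|^2 solves the real equation n' = 2 Re(m) n, and vanishes by
    [first_order_mean_value]; no complex exponential is involved. *)
Lemma first_order_unique (m : C) (f g : R -> C) :
  (forall x, @ex_derive R_AbsRing C_R_NormedModule f x) ->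
  (forall x, @ex_derive R_AbsRing C_R_NormedModule g x) ->
  (forall x, Cminus (DeriveC f x) (Cmult m (f x)) =
             Cminus (DeriveC g x) (Cmult m (g x))) ->
  f 0 = g 0 -> forall x, f x = g x.
Proof.
  intros Df Dg E E0.
  set (h := fun x => Cminus (f x) (g x)).
  set (u := fun x : R => Re (h x)). set (v := fun x : R => Im (h x)).
  assert (Dh : forall x, is_derive_C h x (Cmult m (h x))).
  { intros x. replace (Cmult m (h x)) with (Cminus (DeriveC f x) (DeriveC g x)).
    - apply is_derive_C_minus; apply is_derive_C_DeriveC; auto.
    - unfold h. specialize (E x).
      replace (DeriveC f x) with
        (Cplus (Cminus (DeriveC f x) (Cmult m (f x))) (Cmult m (f x))) by ring.
      rewrite E. ring. }
  assert (Du : forall x : R, is_derive u x (Re m * u x - Im m * v x))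
    by (intros x; apply Dh).
  assert (Dv : forall x : R, is_derive v x (Re m * v x + Im m * u x))
    by (intros x; apply Dh).
  assert (N : forall x, u x * u x + v x * v x = 0).
  { intros x.
    assert (N0 : u 0 * u 0 + v 0 * v 0 = 0).
    { unfold u, v, h. rewrite E0. simpl. ring. }
    destruct (Req_dec x 0) as [-> | Hx]; [exact N0 |].
    destruct (first_order_mean_value (2 * Re m) (fun x => u x * u x + v x * v x)
                (fun _ => 0)) with (x := x) as [c [_ ->]]; auto; [| ring].
    intros y. evar_last.
    - apply (is_derive_plus (fun x : R => u x * u x) (fun x : R => v x * v x)).
      + exact (is_derive_mult u u y _ _ (Du y) (Du y) Rmult_comm).
      + exact (is_derive_mult v v y _ _ (Dv y) (Dv y) Rmult_comm).
    - unfold plus, mult; simpl. ring. }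
  intros x. destruct (Rplus_sqr_eq_0 (u x) (v x) (N x)) as [Hu Hv].
  apply injective_projections.
  - apply Rminus_diag_uniq. exact Hu.
  - apply Rminus_diag_uniq. exact Hv.
Qed.

Lemma DeriveC_n_first_order (m : C) (f : R -> C) (n : nat) :
  (forall k x, (k <= n)%nat ->
     @ex_derive R_AbsRing C_R_NormedModule (DeriveC_n k f) x) ->
  DeriveC_n n (fun x => Cminus (DeriveC f x) (Cmult m (f x))) =
  (fun x => Cminus (DeriveC_n (S n) f x) (Cmult m (DeriveC_n n f x))).
Proof.
  induction n as [|n IH]; intros Hf; [reflexivity |].
  change (DeriveC (DeriveC_n n (fun x => Cminus (DeriveC f x) (Cmult m (f x)))) =
    (fun x => Cminus (DeriveC (DeriveC_n (S n) f) x)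
                     (Cmult m (DeriveC (DeriveC_n n f) x)))).
  rewrite IH by (intros; apply Hf; lia).
  extensionality x. apply is_derive_C_unique.
  apply is_derive_C_minus; [| apply is_derive_C_scal];
    apply is_derive_C_DeriveC, Hf; lia.
Qed.

(** The last exponent of the list is the innermost factor: with
    f1 = f' - m f, the operator of [mu ++ [m]] at [f] is that of [mu] at f1,
    and the derivatives of f1 at 0 are determined by those of [f].  Peeling
    exponents off the end keeps the differentiability needed to the order
    that the hypotheses give. *)
Lemma diff_op_unique (mu : list C) : forall f g : R -> C,
  (forall k x, (k < length mu)%nat ->
     @ex_derive R_AbsRing C_R_NormedModule (DeriveC_n k f) x) ->
  (forall k x, (k < length mu)%nat ->
     @ex_derive R_AbsRing C_R_NormedModule (DeriveC_n k g) x) ->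
  (forall x, diff_op mu f x = diff_op mu g x) ->
  (forall k, (k < length mu)%nat -> DeriveC_n k f 0 = DeriveC_n k g 0) ->
  forall x, f x = g x.
Proof.
  induction mu as [|m mu IH] using rev_ind; intros f g Df Dg E E0;
    [exact E |].
  rewrite length_app in Df, Dg, E0. simpl in Df, Dg, E0.
  unfold diff_op in E. rewrite !fold_right_app in E.
  assert (Diff : forall h : R -> C,
    (forall k x, (k < length mu + 1)%nat ->
       @ex_derive R_AbsRing C_R_NormedModule (DeriveC_n k h) x) ->
    forall k x, (k < length mu)%nat ->
      @ex_derive R_AbsRing C_R_NormedModule
        (DeriveC_n k (fun y => Cminus (DeriveC h y) (Cmult m (h y)))) x).
  { intros h Dh k x Hk.
    rewrite DeriveC_n_first_order by (intros; apply Dh; lia).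
    apply (ex_derive_is_derive_C _ x
      (Cminus (DeriveC (DeriveC_n (S k) h) x) (Cmult m (DeriveC (DeriveC_n k h) x)))).
    apply is_derive_C_minus; [| apply is_derive_C_scal];
      apply is_derive_C_DeriveC, Dh; lia. }
  apply (first_order_unique m).
  - intros x. apply (Df 0%nat). lia.
  - intros x. apply (Dg 0%nat). lia.
  - apply IH; [now apply Diff | now apply Diff | exact E |].
    intros k Hk.
    rewrite (DeriveC_n_first_order m f) by (intros; apply Df; lia).
    rewrite (DeriveC_n_first_order m g) by (intros; apply Dg; lia).
    rewrite (E0 k) by lia. rewrite (E0 (S k)) by lia. reflexivity.
  - apply (E0 0%nat). lia.
Qed.

Lemma Phi_real (mu : list R) (f : R -> R) :
  real_fundamental mu f ->
  Phi (map RtoC mu) = (fun x => RtoC (f x)).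
Proof.
  intros Hf. apply is_fundamental_RtoC in Hf.
  assert (HP : is_fundamental (map RtoC mu) (Phi (map RtoC mu))).
  { unfold Phi. apply epsilon_spec. eexists; exact Hf. }
  destruct Hf as (Df & Of & Zf & If), HP as (DP & OP & ZP & IP).
  extensionality x.
  apply (diff_op_unique (map RtoC mu) (Phi (map RtoC mu)) (fun x => RtoC (f x))); auto.
  - intros y. now rewrite OP, Of.
  - intros k Hk.
    destruct (Nat.eq_dec k (pred (length (map RtoC mu)))) as [-> | Hne].
    + now rewrite IP, If.
    + rewrite ZP, Zf by lia. reflexivity.
Qed.

(** * Signs of fundamental functions and of the numerator of rho *)

Definition phi2 (a b : R) : R -> R := volterra a (fun x => exp (b * x)).

Definition phi3 (a b c : R) : R -> R := volterra a (phi2 b c).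

Definition phi4 (a b c d : R) : R -> R := volterra a (phi3 b c d).

Lemma real_fundamental_phi2 (a b : R) : real_fundamental [a; b] (phi2 a b).
Proof. apply real_fundamental_volterra, real_fundamental_exp. Qed.

Lemma real_fundamental_phi3 (a b c : R) :
  real_fundamental [a; b; c] (phi3 a b c).
Proof. apply real_fundamental_volterra, real_fundamental_phi2. Qed.

Lemma real_fundamental_phi4 (a b c d : R) :
  real_fundamental [a; b; c; d] (phi4 a b c d).
Proof. apply real_fundamental_volterra, real_fundamental_phi3. Qed.

Lemma is_derive_phi2 (a b x : R) :
  is_derive (phi2 a b) x (a * phi2 a b x + exp (b * x)).
Proof.
  apply (is_derive_volterra a (fun x => exp (b * x))), smooth_continuous.
  apply (real_fundamental_exp b).
Qed.

Lemma is_derive_phi3 (a b c x : R) :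
  is_derive (phi3 a b c) x (a * phi3 a b c x + phi2 b c x).
Proof.
  apply is_derive_volterra, smooth_continuous, (real_fundamental_phi2 b c).
Qed.

Lemma is_derive_phi4 (a b c d x : R) :
  is_derive (phi4 a b c d) x (a * phi4 a b c d x + phi3 b c d x).
Proof.
  apply is_derive_volterra, smooth_continuous, (real_fundamental_phi3 b c d).
Qed.

Lemma phi2_sign (a b x : R) : x <> 0 -> 0 < x * phi2 a b x.
Proof.
  apply (first_order_sign_even a _ _ (is_derive_phi2 a b)); [apply volterra_0 |].
  intros; apply exp_pos.
Qed.

Lemma phi3_sign (a b c x : R) : x <> 0 -> 0 < phi3 a b c x.
Proof.
  apply (first_order_sign_odd a _ _ (is_derive_phi3 a b c)); [apply volterra_0 |].
  apply phi2_sign.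
Qed.

Lemma phi4_sign (a b c d x : R) : x <> 0 -> 0 < x * phi4 a b c d x.
Proof.
  apply (first_order_sign_even a _ _ (is_derive_phi4 a b c d)); [apply volterra_0 |].
  apply phi3_sign.
Qed.

Lemma phi2_mult_pos (a b c d x : R) : x <> 0 -> 0 < phi2 a b x * phi2 c d x.
Proof.
  intros Hx. pose proof (phi2_sign a b x Hx). pose proof (phi2_sign c d x Hx).
  apply (Rmult_lt_reg_l (x * x)); [now apply Rsqr_pos_lt |].
  replace (x * x * (phi2 a b x * phi2 c d x))
    with ((x * phi2 a b x) * (x * phi2 c d x)) by ring.
  rewrite Rmult_0_r. now apply Rmult_lt_0_compat.
Qed.

Definition wronskian (f g : R -> R) : R -> R :=
  fun x => Derive f x * g x - f x * Derive g x.

(** Eliminating both derivatives by the first order equations leaves only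
    functions whose derivatives are known. *)
Lemma wronskian_phi4_phi2 (a b c d x : R) :
  wronskian (phi4 a b c d) (phi2 a b) x =
  phi3 b c d x * phi2 a b x - phi4 a b c d x * exp (b * x).
Proof.
  unfold wronskian.
  rewrite (is_derive_unique _ _ _ (is_derive_phi4 a b c d x)).
  rewrite (is_derive_unique _ _ _ (is_derive_phi2 a b x)). ring.
Qed.

(** This is Abel's identity for the operator (d/dx - a)(d/dx - b), with
    forcing term because this operator maps [phi4 a b c d] to [phi2 c d]
    instead of 0. *)
Lemma is_derive_wronskian_phi4_phi2 (a b c d x : R) :
  is_derive (wronskian (phi4 a b c d) (phi2 a b)) x
    ((a + b) * wronskian (phi4 a b c d) (phi2 a b) x + phi2 a b x * phi2 c d x).
Proof.
  apply (is_derive_ext (fun y : R =>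
    phi3 b c d y * phi2 a b y - phi4 a b c d y * exp (b * y))).
  { intros y. symmetry. apply wronskian_phi4_phi2. }
  assert (De : is_derive (fun y : R => exp (b * y)) x (b * exp (b * x))).
  { auto_derive; [trivial | ring]. }
  evar_last.
  - apply (is_derive_minus (fun y : R => phi3 b c d y * phi2 a b y)
      (fun y : R => phi4 a b c d y * exp (b * y))).
    + exact (is_derive_mult _ _ x _ _ (is_derive_phi3 b c d x)
               (is_derive_phi2 a b x) Rmult_comm).
    + exact (is_derive_mult _ _ x _ _ (is_derive_phi4 a b c d x) De Rmult_comm).
  - rewrite wronskian_phi4_phi2. unfold minus, plus, opp, mult; simpl. ring.
Qed.

Lemma wronskian_phi4_phi2_sign (a b c d x : R) : x <> 0 ->
  0 < x * wronskian (phi4 a b c d) (phi2 a b) x.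
Proof.
  apply (first_order_sign_even (a + b) _ _ (is_derive_wronskian_phi4_phi2 a b c d)).
  - rewrite wronskian_phi4_phi2. unfold phi3, phi4. rewrite !volterra_0. ring.
  - apply phi2_mult_pos.
Qed.

Lemma Phi_phi2 (a b : R) :
  Phi [RtoC a; RtoC b] = fun x => RtoC (phi2 a b x).
Proof. apply (Phi_real [a; b]), real_fundamental_phi2. Qed.

Lemma Phi_phi4 (a b c d : R) :
  Phi [RtoC a; RtoC b; RtoC c; RtoC d] = fun x => RtoC (phi4 a b c d x).
Proof. apply (Phi_real [a; b; c; d]), real_fundamental_phi4. Qed.

(** * The entries of the tridiagonal matrix *)

Lemma mult_div_pos (x y z : R) : 0 < z -> 0 < x * y -> 0 < x * (y / z).
Proof.
  intros Hz Hy. unfold Rdiv. rewrite <- Rmult_assoc.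
  apply Rmult_lt_0_compat; [exact Hy | now apply Rinv_0_lt_compat].
Qed.

Lemma sigma_real_sign (a b c d x : R) : x <> 0 ->
  exists s, Defs.sigma (RtoC a) (RtoC b) (RtoC c) (RtoC d) x = RtoC s /\ 0 < x * s.
Proof.
  intros Hx. exists (phi4 a b c d x / (phi2 a b x * phi2 c d x)). split.
  - unfold Defs.sigma. rewrite !Phi_phi2, Phi_phi4.
    rewrite RtoC_div by now apply Rgt_not_eq, phi2_mult_pos.
    now rewrite RtoC_mult.
  - apply mult_div_pos; [now apply phi2_mult_pos | now apply phi4_sign].
Qed.

Lemma rho_real_sign (a b c d x : R) : x <> 0 ->
  exists r, rho (RtoC a) (RtoC b) (RtoC c) (RtoC d) x = RtoC r /\ 0 < x * r.
Proof.
  intros Hx.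
  exists (wronskian (phi4 a b c d) (phi2 a b) x / (phi2 a b x * phi2 c d x)). split.
  - unfold rho. rewrite !Phi_phi2, Phi_phi4, !DeriveC_RtoC.
    rewrite RtoC_div by now apply Rgt_not_eq, phi2_mult_pos.
    unfold wronskian. now rewrite RtoC_minus, !RtoC_mult.
  - apply mult_div_pos;
      [now apply phi2_mult_pos | now apply wronskian_phi4_phi2_sign].
Qed.

Lemma Cpositive_RtoC (x : R) : 0 < x -> Cpositive (RtoC x).
Proof. now split. Qed.

Theorem corollary30 (l0 l1 l2 l3 : R) (n : nat) (t : nat -> R) :
  (3 <= n)%nat ->
  (forall i j : nat, (1 <= i)%nat -> (i < j)%nat -> (j <= n)%nat -> t i < t j) ->
  forall j : nat, (2 <= j)%nat -> (j <= n - 1)%nat ->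
    Cpositive (Rmat (RtoC l0) (RtoC l1) (RtoC l2) (RtoC l3) t j j) /\
    Cpositive (Rmat (RtoC l0) (RtoC l1) (RtoC l2) (RtoC l3) t j (j - 1)) /\
    Cpositive (Rmat (RtoC l0) (RtoC l1) (RtoC l2) (RtoC l3) t j (j + 1)).
Proof.
  intros Hn Ht j Hj1 Hj2.
  assert (Hl : 0 < t j - t (j - 1)%nat) by (apply Rlt_0_minus, Ht; lia).
  assert (Hr : 0 < t (j + 1)%nat - t j) by (apply Rlt_0_minus, Ht; lia).
  unfold Rmat.
  destruct (Nat.eq_dec j j); [| lia].
  destruct (Nat.eq_dec (j - 1) j); [lia |].
  destruct (Nat.eq_dec (j - 1) (j + 1)); [lia |].
  destruct (Nat.eq_dec (j - 1 + 1) j); [| lia].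
  destruct (Nat.eq_dec (j + 1) j); [lia |].
  destruct (Nat.eq_dec (j + 1) (j + 1)); [| lia].
  set (hl := t j - t (j - 1)%nat) in *.
  set (hr := t (j + 1)%nat - t j) in *.
  split; [| split].
  - destruct (rho_real_sign l0 l1 l2 l3 hl) as [r [-> H]]; [lra |].
    destruct (rho_real_sign l0 l1 l2 l3 (- hr)) as [r' [-> H']]; [lra |].
    rewrite <- RtoC_minus. apply Cpositive_RtoC.
    assert (0 < r) by (apply (Rmult_lt_reg_l hl); lra).
    assert (0 < - r') by (apply (Rmult_lt_reg_l hr); lra).
    lra.
  - destruct (sigma_real_sign l0 l1 l2 l3 (- hl)) as [s [-> H]]; [lra |].
    rewrite <- RtoC_opp. apply Cpositive_RtoC, (Rmult_lt_reg_l hl); lra.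
  - destruct (sigma_real_sign l0 l1 l2 l3 hr) as [s [-> H]]; [lra |].
    apply Cpositive_RtoC, (Rmult_lt_reg_l hr); lra.
Qed.
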